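(* Let $\mathbf{k}$ be a commutative unitary ring, $\lambda\in\mathbf{k}$, and let $B$ be a nonunitary $\mathbf{k}$-algebra with a $\mathbf{k}$-basis $X$. Let $\mathrm{Sha}_\lambda(B)$, the product $\diamond$, the operator $R_B$ and the map $j_B$ be as constructed in the context. Then: (a) The pair $(\mathrm{Sha}_\lambda(B),\diamond)$ is a nonunitary associative $\mathbf{k}$-algebra. (b) The triple $(\mathrm{Sha}_\lambda(B),\diamond,R_B)$ is a nonunitary Rota-Baxter algebra of weight $\lambda$. (c) The quadruple $(\mathrm{Sha}_\lambda(B),\diamond,R_B,j_B)$ is the free nonunitary Rota-Baxter algebra of weight $\lambda$ on the algebra $B$. That is, $j_B:B\to \mathrm{Sha}_\lambda(B)$ is a homomorphism of nonunitary algebras, and for every nonunitary Rota-Baxter algebra $(A,R)$ of weight $\lambda$ and every nonunitary algebra homomorphism $f:B\to A$ there is a unique homomorphism of nonunitary Rota-Baxter algebras $\bar f:\mathrm{Sha}_\lambda(B)\to A$ such that $\bar f\circ j_B=f$.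
   Context: A nonunitary $\mathbf{k}$-algebra is an associative $\mathbf{k}$-algebra not required to have a unit. A nonunitary Rota-Baxter algebra of weight $\lambda$ is a pair $(A,R)$ with $A$ a nonunitary $\mathbf{k}$-algebra and $R:A\to A$ a $\mathbf{k}$-linear map such that $R(x)R(y)=R(R(x)y+xR(y)+\lambda xy)$ for all $x,y\in A$. A homomorphism $(A,R)\to(A',R')$ is a nonunitary algebra homomorphism $g$ with $g\circ R=R'\circ g$. Construction of $\mathrm{Sha}_\lambda(B)$. Let $\lfloor$ and $\rfloor$ be two symbols not in $X$, and let $M(X')$ be the free semigroup on $X'=X\cup\{\lfloor,\rfloor\}$. For subsets $Y,Z\subseteq M(X')$ put $$\Lambda_X(Y,Z)=\Big(\bigcup_{r\ge1}(Y\lfloor Z\rfloor)^r\Big)\cup\Big(\bigcup_{r\ge0}(Y\lfloor Z\rfloor)^rY\Big)\cup\Big(\bigcup_{r\ge1}(\lfloor Z\rfloor Y)^r\Big)\cup\Big(\bigcup_{r\ge0}(\lfloor Z\rfloor Y)^r\lfloor Z\rfloor\Big).$$ Let $\mathfrak{X}_0=X$, $\mathfrak{X}_{n+1}=\Lambda_X(X,\mathfrak{X}_n)$ for $n\ge0$, and $\mathfrak{X}_\infty=\bigcup_{n\ge0}\mathfrak{X}_n$ (the sequence is increasing). Elements of $\mathfrak{X}_\infty$ are called Rota-Baxter words. Each $\mathbf{x}\in\mathfrak{X}_\infty$ has a unique standard decomposition $\mathbf{x}=\mathbf{x}_1\cdots\mathbf{x}_b$ in which the $\mathbf{x}_i$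 lie alternately in $X$ and in $\lfloor\mathfrak{X}_\infty\rfloor$; $b=b(\mathbf{x})$ is the breadth of $\mathbf{x}$. The depth is $d(\mathbf{x})=\min\{n:\mathbf{x}\in\mathfrak{X}_n\}$. Let $\mathrm{Sha}_\lambda(B)=\bigoplus_{\mathbf{x}\in\mathfrak{X}_\infty}\mathbf{k}\,\mathbf{x}$, and regard $B=\bigoplus_{x\in X}\mathbf{k}x$ as a submodule. The bilinear product $\diamond$ is defined on basis elements by induction on $d(\mathbf{x})+d(\mathbf{x}')$. If $b(\mathbf{x})=b(\mathbf{x}')=1$: - $\mathbf{x}\diamond\mathbf{x}'$ is the product in $B$ if $\mathbf{x},\mathbf{x}'\in X$; - $\mathbf{x}\diamond\mathbf{x}'=\mathbf{x}\mathbf{x}'$ (concatenation) if exactly one of $\mathbf{x},\mathbf{x}'$ is in $X$ and the other is in $\lfloor\mathfrak{X}_\infty\rfloor$; - $\lfloor\mathbf{u}\rfloor\diamond\lfloor\mathbf{v}\rfloor=\lfloor\lfloor\mathbf{u}\rfloor\diamond\mathbf{v}\rfloor+\lfloor\mathbf{u}\diamond\lfloor\mathbf{v}\rfloor\rfloor+\lambda\lfloor\mathbf{u}\diamond\mathbf{v}\rfloor$ for $\mathbf{u},\mathbf{v}\in\mathfrak{X}_\infty$ (with $\lfloor\ \rfloor$ extended linearly). In general, if $\mathbf{x}=\mathbf{x}_1\cdots\mathbf{x}_b$ and $\mathbf{x}'=\mathbf{x}'_1\cdots\mathbf{x}'_{b'}$ are the standard decompositions, then $\mathbf{x}\diamond\mathbf{x}'=\mathbf{x}_1\cdots\mathbf{x}_{b-1}(\mathbf{x}_b\diamond\mathbf{x}'_1)\mathbf{x}'_2\cdots\mathbf{x}'_{b'}$,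 using concatenation extended linearly. The operator $R_B$ is the linear map with $R_B(\mathbf{x})=\lfloor\mathbf{x}\rfloor$ for $\mathbf{x}\in\mathfrak{X}_\infty$, and $j_B:B\to\mathrm{Sha}_\lambda(B)$ is the linear extension of the inclusion $X\subseteq\mathfrak{X}_\infty$. *)

(* Defs.v *)
From HB Require Import structures.
From mathcomp Require Import all_boot all_order all_algebra finmap.
From mathcomp Require Import boolp classical_sets.
From mathcomp.multinomials Require Import monalg.

Set Implicit Arguments.
Unset Strict Implicit.
Unset Printing Implicit Defensive.

Import GRing.Theory.

Local Open Scope classical_set_scope.
Local Open Scope ring_scope.

Section NonunitaryAlgebras.
Variable k : comPzRingType.

Definition nu_algebra (A : lmodType k) (mul : A -> A -> A) : Prop :=
  [/\ forall y, linear (mul ^~ y), forall x, linear (mul x) & associative mul].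

Definition nu_hom (A A' : lmodType k) (mul : A -> A -> A)
    (mul' : A' -> A' -> A') (g : A -> A') : Prop :=
  linear g /\ {morph g : x y / mul x y >-> mul' x y}.

Definition rota_baxter (lam : k) (A : lmodType k) (mul : A -> A -> A)
    (R : A -> A) : Prop :=
  [/\ nu_algebra mul, linear R &
      forall x y,
        mul (R x) (R y) = R (mul (R x) y + mul x (R y) + lam *: mul x y)].

Definition rb_hom (A A' : lmodType k)
    (mul : A -> A -> A) (R : A -> A) (mul' : A' -> A' -> A') (R' : A' -> A')
    (g : A -> A') : Prop :=
  nu_hom mul mul' g /\ (forall x, g (R x) = R' (g x)).

End NonunitaryAlgebras.

(* [{malg k[K]}] is the group of finitely supported functions [K -> k], but
   its library module structure requires [1 != 0] in [k].  The alias below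
   carries the same structure without that restriction. *)
Definition freemod (k : pzRingType) (K : choiceType) : Type := {malg k[K]}.

Section FreeModule.
Variables (k : pzRingType) (K : choiceType).

HB.instance Definition _ := GRing.Zmodule.on (freemod k K).

Definition fm_scale (c : k) (g : freemod k K) : freemod k K :=
  \sum_(x <- msupp g) << c * g@_x *g x >>.

Lemma fm_scaleE c g x : (fm_scale c g)@_x = c * g@_x.
Proof.
rewrite [in RHS](monalgE g) !raddf_sum mulr_sumr.
by apply/eq_bigr => /= y _; rewrite !mcoeffU mulrnAr.
Qed.

Lemma fm_scaleA c1 c2 g : fm_scale c1 (fm_scale c2 g) = fm_scale (c1 * c2) g.
Proof. by apply/malgP => x; rewrite !fm_scaleE mulrA. Qed.

Lemma fm_scale1 : left_id 1 fm_scale.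
Proof. by move=> g; apply/malgP => x; rewrite fm_scaleE mul1r. Qed.

Lemma fm_scaleDr : right_distributive fm_scale +%R.
Proof.
by move=> c g h; apply/malgP => x; rewrite !(fm_scaleE, mcoeffD) mulrDr.
Qed.

Lemma fm_scaleDl g : {morph fm_scale^~ g : c1 c2 / c1 + c2}.
Proof. by move=> c d; apply/malgP => x; rewrite !(fm_scaleE, mcoeffD) mulrDl. Qed.

HB.instance Definition _ := GRing.Zmodule_isLmodule.Build k (freemod k K)
  fm_scaleA fm_scale1 fm_scaleDr fm_scaleDl.

Definition fbase (x : K) : freemod k K := << x >>.

End FreeModule.
Arguments fbase {k K}.

(* Locked, as unification would otherwise unfold it. *)
HB.lock Definition linext (k : pzRingType) (K : choiceType) (M : lmodType k)
    (f : K -> M) (g : freemod k K) : M :=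
  \sum_(x <- msupp g) g@_x *: f x.

Section LinearExtension.
Variables (k : pzRingType) (K : choiceType).

Lemma linextEw (M : lmodType k) (f : K -> M) (g : freemod k K) (d : {fset K}) :
  (msupp g `<=` d)%fset -> linext f g = \sum_(x <- d) g@_x *: f x.
Proof.
move=> gd; rewrite linext.unlock (big_fset_incl _ gd) // => x _.
by rewrite -mcoeff_eq0 => /eqP ->; rewrite scale0r.
Qed.

Lemma linext_is_linear (M : lmodType k) (f : K -> M) : linear (linext f).
Proof.
move=> c g h; pose d := (msupp (c *: g + h) `|` (msupp g `|` msupp h))%fset.
have cd : (msupp (c *: g + h) `<=` d)%fset by rewrite fsubsetUl.
have gd : (msupp g `<=` d)%fset.
  by apply/fsubsetP => x xg; rewrite !in_fsetU xg orbT.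
have hd : (msupp h `<=` d)%fset.
  by apply/fsubsetP => x xh; rewrite !in_fsetU xh !orbT.
rewrite (linextEw f cd) (linextEw f gd) (linextEw f hd).
rewrite scaler_sumr -big_split; apply: eq_bigr => x _ /=.
by rewrite mcoeffD [X in X + _]fm_scaleE scalerDl scalerA.
Qed.

HB.instance Definition _ (M : lmodType k) (f : K -> M) :=
  GRing.isLinear.Build k (freemod k K) M _ (linext f) (linext_is_linear f).

Lemma linextD (M : lmodType k) (f : K -> M) g h :
  linext f (g + h) = linext f g + linext f h.
Proof. exact: linearD. Qed.

Lemma linextZ (M : lmodType k) (f : K -> M) c g :
  linext f (c *: g) = c *: linext f g.
Proof. exact: linearZ. Qed.

Lemma linext_base (M : lmodType k) (f : K -> M) x : linext f (fbase x) = f x.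
Proof.
rewrite (@linextEw _ f _ [fset x]%fset) ?msuppU_le //.
by rewrite big_seq_fset1 mcoeffUU scale1r.
Qed.

Lemma eq_linext (M : lmodType k) (f f' : K -> M) g :
  (forall x, x \in msupp g -> f x = f' x) -> linext f g = linext f' g.
Proof.
move=> ff'; rewrite !linext.unlock big_seq [RHS]big_seq.
by apply: eq_bigr => x /ff' ->.
Qed.

Lemma linext_comp (M N : lmodType k) (h : {linear M -> N}) (f : K -> M) g :
  h (linext f g) = linext (h \o f) g.
Proof. by rewrite !linext.unlock linear_sum; apply: eq_bigr => x _; rewrite linearZ. Qed.

Lemma linext_id (g : freemod k K) : linext fbase g = g.
Proof.
rewrite linext.unlock [in RHS](monalgE g); apply: eq_bigr => x _.
by apply/malgP => y; rewrite [LHS]fm_scaleE !mcoeffU mulrnAr mulr1.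
Qed.

End LinearExtension.

Definition is_basis (k : comPzRingType) (B : lmodType k) (X : choiceType)
    (e : X -> B) : Prop :=
  (forall c : freemod k X, linext e c = 0 -> c = 0) /\
  (forall b : B, exists c : freemod k X, linext e c = b).

(* The coordinates of [b] in the basis [e]; a junk value if there are none. *)
Definition coord (k : comPzRingType) (B : lmodType k) (X : choiceType)
    (e : X -> B) (b : B) : freemod k X :=
  xget 0 [set c : freemod k X | linext e c = b].

Inductive letter (X : Type) : Type := Gen of X | Lbr | Rbr.
Arguments Lbr {X}.
Arguments Rbr {X}.

Section LetterChoice.
Variable X : choiceType.

Definition letter_code (l : letter X) : X + bool :=
  match l with Gen x => inl x | Lbr => inr true | Rbr => inr false end.
Definition letter_decode (c : X + bool) : letter X :=
  match c with inl x => Gen x | inr b => if b then Lbr else Rbr end.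
Lemma letter_codeK : cancel letter_code letter_decode.
Proof. by case. Qed.
HB.instance Definition _ := Choice.copy (letter X) (can_type letter_codeK).

End LetterChoice.

Section Words.
Variable X : choiceType.

(* Words are lists; the set Lambda(Y, Z) below only contains nonempty ones, so
   it is irrelevant that the free semigroup does not contain the empty word. *)
Notation word := (seq (letter X)).

Definition bracket (w : word) : word := Lbr :: rcons w Rbr.

Definition cat_set (Y Z : set word) : set word :=
  [set u | exists2 y, Y y & exists2 z, Z z & u = y ++ z].
Definition pow_set (Y : set word) (r : nat) : set word :=
  iter r (cat_set Y) [set [::]].
Definition bracket_set (Z : set word) : set word := bracket @` Z.

Definition Lambda (Y Z : set word) : set word :=
  let B := bracket_set Z in
  (\bigcup_(r in [set r | (1 <= r)%N]) pow_set (cat_set Y B) r) `|`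
  (\bigcup_r cat_set (pow_set (cat_set Y B) r) Y) `|`
  (\bigcup_(r in [set r | (1 <= r)%N]) pow_set (cat_set B Y) r) `|`
  (\bigcup_r cat_set (pow_set (cat_set B Y) r) B).

Definition gens : set word := range (fun x : X => [:: Gen x]).

Fixpoint rbwords_upto (n : nat) : set word :=
  if n is n'.+1 then Lambda gens (rbwords_upto n') else gens.

Definition rbwords : set word := \bigcup_n rbwords_upto n.

Definition rbword : choiceType := set_type rbwords.

(* [alternating Z b s]: the members of [s] lie alternately in [X] and in
   [bracket_set Z], starting in [X] if and only if [b] is true. *)
Fixpoint alternating (Z : set word) (b : bool) (s : seq word) : Prop :=
  if s is w :: s' then
    (if b then gens else bracket_set Z) w /\ alternating Z (~~ b) s'
  else True.

Definition std_decomp (w : word) (s : seq word) : Prop :=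
  [/\ s <> [::], exists b, alternating rbwords b s & w = flatten s].

Lemma rbwords_gen x : rbwords [:: Gen x].
Proof. by exists 0%N => //; exists x. Qed.

Lemma rbwords_bracket w : rbwords w -> rbwords (bracket w).
Proof.
move=> [n _ wn]; exists n.+1 => //; right; exists 0%N => //.
by exists [::] => //; exists (bracket w) => //; exists w.
Qed.

Definition rbgen (x : X) : rbword :=
  exist _ [:: Gen x] (mem_set (rbwords_gen x)).

Definition rbbr (u : rbword) : rbword :=
  exist _ (bracket (val u)) (mem_set (rbwords_bracket (set_mem (valP u)))).


Let blocks_of (Z : set word) (b : bool) : set word :=
  if b then gens else bracket_set Z.

Lemma alternating_cat Z b s t : alternating Z b (s ++ t) <->
  alternating Z b s /\ alternating Z (b (+) odd (size s)) t.
Proof.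
elim: s b => [|w s IH] b /=; first by rewrite addbF; tauto.
by rewrite IH addNb -addbN; tauto.
Qed.

Lemma alternating_sub Z Z' b s :
  Z `<=` Z' -> alternating Z b s -> alternating Z' b s.
Proof.
move=> ZZ'; elim: s b => //= w s IH b [ws als]; split; last exact: IH.
by case: b ws {als} => // -[u /ZZ' Zu <-]; exists u.
Qed.

Lemma pow_set_alternating Z b r w :
  pow_set (cat_set (blocks_of Z b) (blocks_of Z (~~ b))) r w <->
  exists s, [/\ size s = r.*2, alternating Z b s & w = flatten s].
Proof.
split; elim: r w => [|r IH] w.
- by move=> ->; exists [::].
- move=> [y [y1 h1 [y2 h2 ->]] [z /IH [s [sz als ->]] ->]].
  exists [:: y1, y2 & s]; split; rewrite /= ?sz ?catA //.
  by rewrite negbK.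
- by move=> [[|u s] [// _ _ ->]].
- move=> [[|y1 [|y2 s]] [//= [sz] [h1 [h2]]]]; rewrite negbK => als ->.
  exists (y1 ++ y2); last by exists (flatten s); [apply: IH; exists s|rewrite catA].
  by exists y1 => //; exists y2.
Qed.

Lemma LambdaP Z w : Lambda gens Z w <->
  exists s, [/\ s <> [::], exists b, alternating Z b s & w = flatten s].
Proof.
pose P b := pow_set (cat_set (blocks_of Z b) (blocks_of Z (~~ b))).
have PE b r u : P b r u <->
  exists s, [/\ size s = r.*2, alternating Z b s & u = flatten s].
  exact: pow_set_alternating.
have QE b r u : cat_set (P b r) (blocks_of Z b) u <->
  exists s, [/\ size s = r.*2.+1, alternating Z b s & u = flatten s].
  split.
    move=> [y /PE [s [sz als ->]] [z hz ->]]; exists (s ++ [:: z]); split.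
    - by rewrite size_cat sz addn1.
    - by apply/alternating_cat; rewrite sz odd_double addbF.
    - by rewrite flatten_cat /= cats0.
  move=> [s [sz]]; case/lastP: s sz => // s z; rewrite size_rcons => -[sz].
  rewrite -cats1 flatten_cat /= cats0 => /alternating_cat.
  rewrite sz odd_double addbF => -[als [hz _]] ->.
  by exists (flatten s); [apply/PE; exists s|exists z].
split.
  move=> [[[]|]|] [r hr h].
  - have /PE [s [sz als ->]] : P true r w by [].
    by exists s; split=> //; [move=> s0; move: hr sz; rewrite s0; case: (r)|exists true].
  - have /QE [s [sz als ->]] : cat_set (P true r) (blocks_of Z true) w by [].
    by exists s; split=> //; [move=> s0; move: sz; rewrite s0|exists true].
  - have /PE [s [sz als ->]] : P false r w by [].
    by exists s; split=> //; [move=> s0; move: hr sz; rewrite s0; case: (r)|exists false].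
  - have /QE [s [sz als ->]] : cat_set (P false r) (blocks_of Z false) w by [].
    by exists s; split=> //; [move=> s0; move: sz; rewrite s0|exists false].
move=> [s [s0 [b als] ->]].
have := odd_double_half (size s); case: (odd (size s)) => /esym sz.
  have h : cat_set (P b (size s)./2) (blocks_of Z b) (flatten s).
    by apply/QE; exists s.
  by case: b {als} h => h; [left; left; right|right]; exists (size s)./2.
have h : P b (size s)./2 (flatten s) by apply/PE; exists s.
have r0 : (1 <= (size s)./2)%N.
  by rewrite half_gt0; case: (s) s0 sz => // u [].
by case: b {als} h => h; [left; left; left|left; right]; exists (size s)./2.
Qed.

Lemma rbwords_uptoS n : rbwords_upto n `<=` rbwords_upto n.+1.
Proof.
elim: n => [|n IH] w.
  by move=> gw; apply/LambdaP; exists [:: w]; split; [|exists true|rewrite /= cats0].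
move=> /LambdaP [s [s0 [b als] ->]]; apply/LambdaP; exists s; split=> //.
by exists b; apply: alternating_sub als.
Qed.

Lemma rbwords_upto_le m n : (m <= n)%N -> rbwords_upto m `<=` rbwords_upto n.
Proof.
move=> /subnK <-; elim: (n - m)%N => // d IH w /IH.
exact: rbwords_uptoS.
Qed.

Lemma rbwordsP w : rbwords w <-> exists s, std_decomp w s.
Proof.
split.
  move=> [[|n] _ wn].
    by exists [:: w]; split; [|exists true|rewrite /= cats0].
  move/LambdaP: wn => [s [s0 [b als] ->]]; exists s; split=> //; exists b.
  by apply: alternating_sub als => u un; exists n.
move=> [s [s0 [b als] ->]].
suff [n aln] : exists n, alternating (rbwords_upto n) b s.
  by exists n.+1 => //; apply/LambdaP; exists s; split=> //; exists b.
elim: s b als {s0} => [|v s IH] b /=; first by exists 0%N.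
move=> [hw /IH [n aln]]; case: b hw {IH} aln => hw aln; first by exists n.
case: hw => u [m _ um] <-; exists (maxn m n); split.
  by exists u => //; apply: rbwords_upto_le um; rewrite leq_maxl.
by apply: alternating_sub aln; apply: rbwords_upto_le; rewrite leq_maxr.
Qed.

(* Cuts a word into its standard decomposition; [d] is the number of brackets
   currently open and [cur] the part already read of the current block. *)
Fixpoint cut (w : word) (d : nat) (cur : word) : seq word :=
  match w, d with
  | [::], _ => [::]
  | Gen x :: w', 0%N => [:: Gen x] :: cut w' 0 [::]
  | Gen x :: w', _ => cut w' d (rcons cur (Gen x))
  | Lbr :: w', _ => cut w' d.+1 (rcons cur Lbr)
  | Rbr :: w', 1%N => rcons cur Rbr :: cut w' 0 [::]
  | Rbr :: w', _ => cut w' d.-1 (rcons cur Rbr)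
  end.

Lemma cut_rbword u d cur w : rbwords u ->
  cut (u ++ w) d.+1 cur = cut w d.+1 (cur ++ u).
Proof.
move=> [n _]; elim: n u d cur w => [|n IH] u d cur w.
  by move=> [x _ <-]; rewrite /= cats1.
move=> /LambdaP [s [_ [b als] ->]]; elim: s b als cur => [|v s IHs] b /=.
  by move=> _ cur; rewrite cats0.
move=> [hv /IHs {}IHs] cur; rewrite -catA.
case: b hv IHs => -[y hy <-] IHs /=; first by rewrite IHs cat_rcons.
by rewrite -cats1 -!catA (IH _ _ _ _ hy) /= IHs -!cats1 -!catA.
Qed.

Lemma cut_flatten b s : alternating rbwords b s -> cut (flatten s) 0 [::] = s.
Proof.
elim: s b => //= v s IH b [hv /IH {}IH]; case: b hv => -[y hy <-] /=.
  by rewrite IH.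
by rewrite -cats1 -catA cut_rbword //= IH.
Qed.

Lemma std_decomp_cut w s : std_decomp w s -> cut w 0 [::] = s.
Proof. by move=> [_ [b als] ->]; apply: cut_flatten als. Qed.

Lemma std_decomp_exists_unique w : rbwords w -> exists! s, std_decomp w s.
Proof.
move=> /rbwordsP [s ws]; exists s; split=> // t wt.
by rewrite -(std_decomp_cut ws) (std_decomp_cut wt).
Qed.

End Words.

Notation Sha k X := (freemod k (rbword X)).

Section Product.
Variables (k : comPzRingType) (lam : k).
Variables (B : lmodType k) (mulB : B -> B -> B) (X : choiceType) (e : X -> B).

Notation word := (seq (letter X)).
Notation rbword := (rbword X).
Notation Sha := (Sha k X).

Definition R_B : Sha -> Sha := linext (fun u : rbword => fbase (rbbr u) : Sha).

Definition j_B (b : B) : Sha :=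
  linext (fun x : X => fbase (rbgen x) : Sha) (coord e b).

(* The linear extension of [w |-> p w q].  As [p w q] need not be a Rota-Baxter
   word, its values are taken in the free module on all words. *)
Definition wrap (p q : word) : Sha -> freemod k word :=
  linext (fun w : rbword => fbase (p ++ val w ++ q)).

Definition as_words : Sha -> freemod k word := wrap [::] [::].

(* The recursive equations for the product of two basis elements.  They are
   solvable (lemma [diamond_exists]), and induction on the lengths of the
   words shows that the solution is unique (lemma [diamond_unique]). *)
Record diamond_spec (D : rbword -> rbword -> Sha) : Prop := {
  diamond_gen_gen : forall x y : X,
    D (rbgen x) (rbgen y) = j_B (mulB (e x) (e y));
  diamond_gen_br : forall (x : X) (u : rbword),
    as_words (D (rbgen x) (rbbr u)) = fbase (val (rbgen x) ++ val (rbbr u));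
  diamond_br_gen : forall (x : X) (u : rbword),
    as_words (D (rbbr u) (rbgen x)) = fbase (val (rbbr u) ++ val (rbgen x));
  diamond_br_br : forall u v : rbword,
    D (rbbr u) (rbbr v) =
      R_B (D (rbbr u) v) + R_B (D u (rbbr v)) + lam *: R_B (D u v);
  diamond_concat : forall (x x' a b : rbword) (p q : seq word),
    std_decomp (val x) (rcons p (val a)) ->
    std_decomp (val x') (val b :: q) ->
    as_words (D x x') = wrap (flatten p) (flatten q) (D a b)
}.

Let block (c : bool) (w : word) : Prop :=
  (if c then @gens X else bracket_set (@rbwords X)) w.

Let to_Sha (w : word) : Sha := oapp fbase 0 (insub w : option rbword).

Let to_ShaE (x : rbword) : to_Sha (val x) = fbase x.
Proof. by rewrite /to_Sha valK. Qed.

Lemma as_words_inj : injective as_words.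
Proof.
suff h : cancel as_words (linext to_Sha) by exact: can_inj h.
move=> g; rewrite /as_words /wrap linext_comp -[RHS]linext_id.
by apply: eq_linext => x _ /=; rewrite linext_base cats0 to_ShaE.
Qed.

Let block_rbwords c w : block c w -> rbwords w.
Proof. by case: c => -[u hu <-]; [apply: rbwords_gen|apply: rbwords_bracket]. Qed.

Let decomp_last x p a : std_decomp x (rcons p a) -> exists c, exists b,
  [/\ alternating (@rbwords X) b p, c = b (+) odd (size p), block c a &
      x = flatten p ++ a].
Proof.
rewrite -cats1 => -[_ [b /alternating_cat [alp [ha _]]] ->].
by exists (b (+) odd (size p)), b; rewrite flatten_cat /= cats0.
Qed.

Let decomp_first x b q : std_decomp x (b :: q) -> exists c,
  [/\ block c b, alternating (@rbwords X) (~~ c) q & x = b ++ flatten q].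
Proof. by move=> [_ [c [hb alq]] ->]; exists c. Qed.

Let glue1 b p w q c : alternating (@rbwords X) b p -> c = b (+) odd (size p) ->
  block c w -> alternating (@rbwords X) (~~ c) q ->
  rbwords (flatten p ++ w ++ flatten q).
Proof.
move=> alp -> hw alq; apply/rbwordsP; exists (p ++ w :: q); split.
- by case: (p).
- by exists b; apply/alternating_cat.
- by rewrite flatten_cat.
Qed.

Let glue2 b p w w' q c : alternating (@rbwords X) b p ->
  c = b (+) odd (size p) -> block c w -> block (~~ c) w' ->
  alternating (@rbwords X) c q ->
  rbwords (flatten p ++ (w ++ w') ++ flatten q).
Proof.
move=> alp cE hw hw' alq; apply/rbwordsP; exists (p ++ [:: w, w' & q]); split.
- by case: (p).
- by exists b; apply/alternating_cat; rewrite -cE /= negbK.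
- by rewrite flatten_cat /= -!catA.
Qed.

Let cut0 (x : rbword) : seq word := cut (val x) 0 [::].
Let lastb (x : rbword) : rbword := insubd x (last [::] (cut0 x)).
Let firstb (x : rbword) : rbword := insubd x (head [::] (cut0 x)).
Let pre (x : rbword) : word := flatten (take (size (cut0 x)).-1 (cut0 x)).
Let post (x : rbword) : word := flatten (behead (cut0 x)).
Let unbr (a : rbword) : rbword := xget a [set u | a = rbbr u].

Let val_rbword (x : rbword) : rbwords (val x).
Proof. exact: set_mem (valP x). Qed.

Let lastbE x p a : std_decomp (val x) (rcons p (val a)) ->
  lastb x = a /\ pre x = flatten p.
Proof.
move=> /std_decomp_cut h; rewrite /lastb /pre /cut0 h last_rcons valKd.
by rewrite size_rcons /= -cats1 take_size_cat.
Qed.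

Let firstbE x b q : std_decomp (val x) (val b :: q) ->
  firstb x = b /\ post x = flatten q.
Proof.
by move=> /std_decomp_cut h; rewrite /firstb /post /cut0 h /= valKd.
Qed.

Let lastbP x : exists p, std_decomp (val x) (rcons p (val (lastb x))).
Proof.
have /rbwordsP [s xs] := val_rbword x.
case/lastP: s xs => [[]//|p a] xs; exists p.
have [c [b [_ _ /block_rbwords ha _]]] := decomp_last xs.
pose a' : rbword := exist _ a (mem_set ha).
by have [->] : lastb x = a' /\ pre x = flatten p by exact: lastbE.
Qed.

Let firstbP x : exists q, std_decomp (val x) (val (firstb x) :: q).
Proof.
have /rbwordsP [[|b q] xs] := val_rbword x; first by case: xs.
exists q; have [c [/block_rbwords hb _ _]] := decomp_first xs.
pose b' : rbword := exist _ b (mem_set hb).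
by have [->] : firstb x = b' /\ post x = flatten q by exact: firstbE.
Qed.

Let rbgen_inj : injective (@rbgen X).
Proof. by move=> x y /(congr1 val) [->]. Qed.

Let rbbr_inj : injective (@rbbr X).
Proof. by move=> u v /(congr1 val) [/rcons_inj [/val_inj]]. Qed.

Let size_rbbr (u : rbword) : size (val (rbbr u)) = (size (val u)).+2.
Proof. by rewrite /= size_rcons. Qed.

Let unbrK (u : rbword) : unbr (rbbr u) = u.
Proof.
have : [set v | rbbr u = rbbr v] (unbr (rbbr u)) by apply: xgetPex; exists u.
by move=> /rbbr_inj.
Qed.

Let block_cases c (a : rbword) : block c (val a) ->
  if c then exists x, a = rbgen x else exists u, a = rbbr u.
Proof.
case: c => -[u hu ua]; first by exists u; apply: val_inj.
by exists (exist _ u (mem_set hu)); apply: val_inj; rewrite -ua.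
Qed.

Let lastb_block x : exists c, block c (val (lastb x)).
Proof. by have [p /decomp_last [c [b [_ _ h _]]]] := lastbP x; exists c. Qed.

Let firstb_block x : exists c, block c (val (firstb x)).
Proof. by have [q /decomp_first [c [h _ _]]] := firstbP x; exists c. Qed.

Let size_lastb x : (size (val (lastb x)) <= size (val x))%N.
Proof.
have [p /decomp_last [c [b [_ _ _ xE]]]] := lastbP x.
by rewrite [X in (_ <= size X)%N]xE size_cat leq_addl.
Qed.

Let size_firstb x : (size (val (firstb x)) <= size (val x))%N.
Proof.
have [q /decomp_first [c [_ _ xE]]] := firstbP x.
by rewrite [X in (_ <= size X)%N]xE size_cat leq_addr.
Qed.

(* The product of two words of breadth one, where [rec] is the product of
   smaller words. *)
Let core (rec : rbword -> rbword -> Sha) (a b : rbword) : Sha :=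
  match val a, val b with
  | Gen x :: _, Gen y :: _ => j_B (mulB (e x) (e y))
  | Lbr :: _, Lbr :: _ =>
    R_B (rec a (unbr b)) + R_B (rec (unbr a) b) +
    lam *: R_B (rec (unbr a) (unbr b))
  | _, _ => to_Sha (val a ++ val b)
  end.

Let pad (p q : word) : Sha -> Sha :=
  linext (fun w : rbword => to_Sha (p ++ val w ++ q)).

Let pad0 z : pad [::] [::] z = z.
Proof.
rewrite -[RHS]linext_id; apply: eq_linext => x _.
by rewrite cats0 to_ShaE.
Qed.

Let Fixpoint diamond_rec (n : nat) (x y : rbword) : Sha :=
  if n is n'.+1 then
    pad (pre x) (post y) (core (diamond_rec n') (lastb x) (firstb y))
  else 0.

Let core_gen_gen rec x y :
  core rec (rbgen x) (rbgen y) = j_B (mulB (e x) (e y)).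
Proof. by rewrite /core /=. Qed.

Let core_gen_br rec x (u : rbword) :
  core rec (rbgen x) (rbbr u) = to_Sha (val (rbgen x) ++ val (rbbr u)).
Proof. by rewrite /core /=. Qed.

Let core_br_gen rec x (u : rbword) :
  core rec (rbbr u) (rbgen x) = to_Sha (val (rbbr u) ++ val (rbgen x)).
Proof. by rewrite /core /=. Qed.

Let core_br_br rec (u v : rbword) : core rec (rbbr u) (rbbr v) =
  R_B (rec (rbbr u) v) + R_B (rec u (rbbr v)) + lam *: R_B (rec u v).
Proof.
have -> : core rec (rbbr u) (rbbr v) =
    R_B (rec (rbbr u) (unbr (rbbr v))) + R_B (rec (unbr (rbbr u)) (rbbr v)) +
    lam *: R_B (rec (unbr (rbbr u)) (unbr (rbbr v))) by [].
by rewrite !unbrK.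
Qed.

Let core_ext rec rec' a b :
  (exists c, block c (val a)) -> (exists c, block c (val b)) ->
  (forall x y, (size (val x) + size (val y) < size (val a) + size (val b))%N ->
     rec x y = rec' x y) ->
  core rec a b = core rec' a b.
Proof.
move=> [c /block_cases ha] [d /block_cases hb] h.
case: c d ha hb => -[] [x ax] [y b_y]; subst a b.
- by rewrite !core_gen_gen.
- by rewrite !core_gen_br.
- by rewrite !core_br_gen.
rewrite (core_br_br rec) (core_br_br rec') (h (rbbr x) y); last first.
  by rewrite ltn_add2l size_rbbr.
rewrite (h x (rbbr y)); last by rewrite ltn_add2r size_rbbr.
have xy : (size (val x) + size (val y) < (size (val x)).+2 + (size (val y)).+2)%N.
  by rewrite !addSn !addnS; do 3!apply: ltnW.
by rewrite (h x y) // !size_rbbr.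
Qed.

Let diamond_rec_stable n m x y : (size (val x) + size (val y) < n)%N ->
  (size (val x) + size (val y) < m)%N -> diamond_rec n x y = diamond_rec m x y.
Proof.
elim: n m x y => // n IH [//|m] x y xn xm /=.
rewrite (core_ext (rec' := diamond_rec m) (lastb_block x) (firstb_block y)) //.
move=> u v uv.
have le : (size (val u) + size (val v) < size (val x) + size (val y))%N.
  by apply: leq_trans uv _; rewrite leq_add.
by apply: IH; apply: leq_trans le _; rewrite -ltnS.
Qed.

Let D0 (x y : rbword) : Sha :=
  diamond_rec (size (val x) + size (val y)).+1 x y.

Let D0E x y : D0 x y = pad (pre x) (post y) (core D0 (lastb x) (firstb y)).
Proof.
have -> : D0 x y = pad (pre x) (post y)
    (core (diamond_rec (size (val x) + size (val y))) (lastb x) (firstb y)).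
  by [].
rewrite (core_ext (rec := diamond_rec _) (rec' := D0) (lastb_block x) (firstb_block y)) // => u v uv.
apply: diamond_rec_stable => //; apply: leq_trans uv _.
by rewrite leq_add.
Qed.

Let D0_block c d a b : block c (val a) -> block d (val b) ->
  D0 a b = core D0 a b.
Proof.
move=> ha hb.
have da : std_decomp (val a) (rcons [::] (val a)).
  by split=> //; [exists c|rewrite /= cats0].
have db : std_decomp (val b) (val b :: [::]).
  by split=> //; [exists d|rewrite /= cats0].
have [la pa] := lastbE da; have [fb pb] := firstbE db.
by rewrite D0E la pa fb pb pad0.
Qed.

(* [z] only involves words [w] such that [p w q] is a Rota-Baxter word *)
Let fits (p q : word) (z : Sha) : Prop := as_words (pad p q z) = wrap p q z.

Let fitsD p q z1 z2 : fits p q z1 -> fits p q z2 -> fits p q (z1 + z2).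
Proof. by rewrite /fits /as_words /pad /wrap !linextD => -> ->. Qed.

Let fitsZ p q a z : fits p q z -> fits p q (a *: z).
Proof. by rewrite /fits /as_words /pad /wrap !linextZ => ->. Qed.

Let fits_linext (K : choiceType) p q (f : K -> Sha) g :
  (forall x, fits p q (f x)) -> fits p q (linext f g).
Proof.
rewrite /fits /as_words /pad /wrap => h.
by rewrite 3!(linext_comp _ _ g); apply: eq_linext => x _; exact: h.
Qed.

Let fits_base p q (w : rbword) :
  rbwords (p ++ val w ++ q) -> fits p q (fbase w).
Proof.
move=> h; pose w' : rbword := exist _ (p ++ val w ++ q) (mem_set h).
rewrite /fits /pad /wrap !linext_base (to_ShaE w') /as_words /wrap.
by rewrite linext_base /= cats0.
Qed.

Let block_gen (x : X) : block true (val (rbgen x)).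
Proof. by exists x. Qed.

Let block_br (u : rbword) : block false (val (rbbr u)).
Proof. by exists (val u). Qed.

Let D0_spec : diamond_spec D0.
Proof.
have mixed (a b : rbword) : rbwords (val a ++ val b) ->
    as_words (to_Sha (val a ++ val b)) = fbase (val a ++ val b).
  move=> h; pose w' : rbword := exist _ (val a ++ val b) (mem_set h).
  by rewrite (to_ShaE w') /as_words /wrap linext_base /= cats0.
have adj (a b : rbword) c : block c (val a) -> block (~~ c) (val b) ->
    rbwords (val a ++ val b).
  move=> ha hb; have := @glue2 c [::] _ _ [::] c _ _ ha hb.
  by rewrite /= cats0; apply; rewrite ?addbF.
split.
- by move=> x y; rewrite (D0_block (block_gen x) (block_gen y)).
- move=> x u; rewrite (D0_block (block_gen x) (block_br u)).
  by rewrite core_gen_br mixed //; exact: adj (block_gen x) (block_br u).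
- move=> x u; rewrite (D0_block (block_br u) (block_gen x)).
  by rewrite core_br_gen mixed //; exact: adj (block_br u) (block_gen x).
- move=> u v; rewrite (D0_block (block_br u) (block_br v)).
  exact: core_br_br.
move=> x x' a b p q xa xb.
have [la pa] := lastbE xa; have [fb pb] := firstbE xb.
rewrite D0E la pa fb pb.
have [c [c0 [alp cE ha _]]] := decomp_last xa.
have [d [hb alq _]] := decomp_first xb.
rewrite (D0_block ha hb).
have gl1 w : block c w -> c = d -> rbwords (flatten p ++ w ++ flatten q).
  by move=> hw cd; apply: glue1 alp cE hw _; rewrite cd.
rewrite -/(fits _ _ _).
have gens_fit g : c -> d -> fits (flatten p) (flatten q) (j_B g).
  move=> cT dT; apply: fits_linext => z; apply: fits_base.
  by apply: gl1; rewrite ?cT ?dT //; exists z.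
have brs_fit g : ~~ c -> ~~ d -> fits (flatten p) (flatten q) (R_B g).
  move=> /negbTE cF /negbTE dF; apply: fits_linext => z; apply: fits_base.
  by apply: gl1; rewrite ?cF ?dF //; exists (val z).
have mixed_fit : d = ~~ c ->
    fits (flatten p) (flatten q) (to_Sha (val a ++ val b)).
  move=> dc; have hb' : block (~~ c) (val b) by rewrite -dc.
  have h := adj _ _ _ ha hb'; pose w' : rbword := exist _ (val a ++ val b) (mem_set h).
  rewrite (to_ShaE w'); apply: fits_base; apply: glue2 alp cE ha hb' _.
  by move: alq; rewrite dc negbK.
have := (block_cases ha, block_cases hb).
case: (c) (d) gens_fit brs_fit mixed_fit => -[] gf bf mf [[y yE] [z zE]];
  rewrite yE zE in mf *.
- by rewrite core_gen_gen; apply: gf.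
- by rewrite core_gen_br; apply: mf.
- by rewrite core_br_gen; apply: mf.
rewrite core_br_br; apply: fitsD; last by apply: fitsZ; apply: bf.
by apply: fitsD; apply: bf.
Qed.

Lemma diamond_exists : exists D, diamond_spec D.
Proof. by exists D0; exact: D0_spec. Qed.

Lemma diamond_unique D D' : diamond_spec D -> diamond_spec D' -> D =2 D'.
Proof.
move=> SD SD' x y; have [n] := ubnP (size (val x) + size (val y)).
elim: n x y => // n IH x y; rewrite ltnS => xy.
have [[p xp] [q yq]] := (lastbP x, firstbP y).
apply: as_words_inj.
rewrite (diamond_concat SD xp yq) (diamond_concat SD' xp yq); congr (wrap _ _ _).
have le : (size (val (lastb x)) + size (val (firstb y)) <= n)%N.
  by apply: leq_trans xy; rewrite leq_add.
have [c /block_cases hc] := lastb_block x.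
have [d /block_cases hd] := firstb_block y.
case: c d hc hd => -[] [u uE] [v vE]; rewrite uE vE in le *.
- by rewrite (diamond_gen_gen SD) (diamond_gen_gen SD').
- by apply: as_words_inj; rewrite (diamond_gen_br SD) (diamond_gen_br SD').
- by apply: as_words_inj; rewrite (diamond_br_gen SD) (diamond_br_gen SD').
rewrite (diamond_br_br SD) (diamond_br_br SD').
have lt w w' : (size (val w) + size (val w') <
    size (val (rbbr u)) + size (val (rbbr v)))%N -> D w w' = D' w w'.
  by move=> ww'; apply: IH; apply: leq_trans ww' le.
rewrite (lt (rbbr u) v); last by rewrite ltn_add2l size_rbbr.
rewrite (lt u (rbbr v)); last by rewrite ltn_add2r size_rbbr.
rewrite (lt u v) // !size_rbbr !addSn !addnS.
by do 3!apply: ltnW.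
Qed.

Definition diamond_base : rbword -> rbword -> Sha :=
  projT1 (cid diamond_exists).

Lemma diamond_baseP : diamond_spec diamond_base.
Proof. exact: projT2 (cid diamond_exists). Qed.

Definition diamond (f g : Sha) : Sha :=
  linext (fun x => linext (diamond_base x) g) f.

End Product.

(* Main.v *)
From HB Require Import structures.
Require Import Defs.
From mathcomp Require Import all_boot all_order all_algebra.
From mathcomp Require Import finmap boolp classical_sets.
From mathcomp.multinomials Require Import monalg.

Set Implicit Arguments.
Unset Strict Implicit.
Unset Printing Implicit Defensive.

Import GRing.Theory.

(** The product [x ** y] of two words [x] and [y] only alters the last block of
[x] and the first block of [y]; everything to the left and to the right is
carried along by concatenation.  Call [x] and [y] composable if the last block
of [x] and the first block of [y] are of different kinds, one a generator and
the other bracketed.  Then [x ** y] is the word [xy], and in general [x ** y]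
is a combination of words that start like [x] and end like [y]
([diamond_starts], [diamond_ends]): two blocks of the same kind multiply to a
combination of blocks of that kind.

Associativity.  If [x] and [y] are composable, then [(xy) ** z] and
[x ** (y ** z)] both arise from [y ** z] by writing [x] in front, since every
word of [y ** z] starts like [y] ([associates_left]); symmetrically if [y] and
[z] are composable ([associates_right]).  Cutting [x], [y] and [z] between
blocks and moving parentheses across these cuts reduces the claim to three
blocks of the same kind ([associates_of_blocks]).  For generators it is the
associativity of [B].  For brackets, the Rota-Baxter identity expands both
sides of
  [(R f ** R g) ** R h = R f ** (R g ** R h)]
into [R] of seven terms, which match in pairs by associativity of triples of
smaller total length ([rota_baxter_assoc], [diamond_assoc]).

Freeness.  A homomorphism extending [f : B -> A] has to send a generator [x]
to [f (e x)], a bracket to [R] of the value of its content and a concatenation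
of words to the product of their values.  Reading a word letter by letter with
a stack of pending products computes such a value ([eval]), so the extension
[fbar] exists as a linear map and is the only candidate ([fbar_unique]).  That
[fbar] is multiplicative is proved by the same reduction to blocks as
associativity ([fbarM]). *)

(** * Linear maps out of a free module *)

(** A sealed copy of [fbase], so that comparing two distinct basis vectors does
not unfold the encoding of finitely supported functions. *)
HB.lock Definition bvec (k : pzRingType) (K : choiceType) (x : K) :
    freemod k K := fbase x.
Arguments bvec {k K}.

Section Span.
Local Open Scope ring_scope.
Variable k : comPzRingType.

Lemma linear_comp (U V W : lmodType k) (F : V -> W) (G : U -> V) :
  linear F -> linear G -> linear (fun x => F (G x)).
Proof. by move=> lF lG c x y; rewrite lG lF. Qed.

Lemma linear_add (U V : lmodType k) (F : U -> V) x y :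
  linear F -> F (x + y) = F x + F y.
Proof. by move=> lF; rewrite -[x]scale1r lF !scale1r. Qed.

Lemma linear_scale (U V : lmodType k) (F : U -> V) c x :
  linear F -> F (c *: x) = c *: F x.
Proof.
move=> lF; have F0 : F 0 = 0.
  by apply: (addrI (F 0)); rewrite -(linear_add _ _ lF) !addr0.
by rewrite -[c *: x]addr0 lF F0 addr0.
Qed.

(** The inductive step for associativity on bracketed arguments: expanding the
two sides by the Rota-Baxter identity gives [R] applied to seven terms each,
and these are matched by the seven hypotheses.  Only these instances of
associativity are assumed, as the lemma is applied inside an induction. *)
Lemma rota_baxter_assoc (lam : k) (A : lmodType k) (m : A -> A -> A)
    (R : A -> A) (f g h : A) :
  (forall y, linear (m ^~ y)) -> (forall x, linear (m x)) -> linear R ->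
  (forall x y, m (R x) (R y) = R (m (R x) y + m x (R y) + lam *: m x y)) ->
  m (m (R f) (R g)) h = m (R f) (m (R g) h) ->
  m (m (R f) g) (R h) = m (R f) (m g (R h)) ->
  m (m f (R g)) (R h) = m f (m (R g) (R h)) ->
  m (m (R f) g) h = m (R f) (m g h) ->
  m (m f (R g)) h = m f (m (R g) h) ->
  m (m f g) (R h) = m f (m g (R h)) ->
  m (m f g) h = m f (m g h) ->
  m (m (R f) (R g)) (R h) = m (R f) (m (R g) (R h)).
Proof.
move=> ml mr lR RB e1 e2 e3 e4 e5 e6 e7.
have mDl z x y : m (x + y) z = m x z + m y z by apply: linear_add (ml z).
have mDr z x y : m z (x + y) = m z x + m z y by apply: linear_add (mr z).
have mZl z c x : m (c *: x) z = c *: m x z by apply: linear_scale (ml z).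
have mZr z c x : m z (c *: x) = c *: m z x by apply: linear_scale (mr z).
(* The argument of [R] in [R f * R g] again multiplies [R h], so one term of
   the expansion contains [R] of it, which folds back to [R f * R g]. *)
have [RBfg RBgh] := (RB f g, RB g h).
rewrite [in LHS]RBfg [in RHS]RBgh !RB -RBfg -RBgh.
congr R; rewrite !(mDl, mDr, mZl, mZr) !scalerDr e1 e2 e3 e4 e5 e6 e7.
by rewrite [LHS](AC ((1*3)*3) ((1*2*5)*3*(6*4*7))).
Qed.

Lemma linext_bvec (K : choiceType) (M : lmodType k) (f : K -> M) x :
  linext f (bvec x) = f x.
Proof. by rewrite bvec.unlock linext_base. Qed.

Lemma linear_linext (K : choiceType) (M : lmodType k) (F : freemod k K -> M) g :
  linear F -> F g = linext (fun x => F (bvec x)) g.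
Proof.
move=> lF; rewrite -{1}(linext_id g) bvec.unlock.
pose F' : {linear freemod k K -> M} :=
  HB.pack F (GRing.isLinear.Build k _ _ _ F lF).
exact: (linext_comp F').
Qed.

Lemma linear_linext_param (K : choiceType) (U M : lmodType k)
    (F : K -> U -> M) (g : freemod k K) :
  (forall x, linear (F x)) -> linear (fun u => linext (fun x => F x u) g).
Proof.
move=> lF c u v; rewrite !linext.unlock scaler_sumr -big_split /=.
by apply: eq_bigr => x _; rewrite lF scalerDr !scalerA mulrC.
Qed.

Definition spanned (K : choiceType) (P : K -> Prop) (g : freemod k K) : Prop :=
  forall x, x \in msupp g -> P x.

Lemma spanned_fbase (K : choiceType) (P : K -> Prop) x :
  P x -> spanned P (fbase x).
Proof. by move=> Px y /(fsubsetP msuppU_le); rewrite inE => /eqP ->. Qed.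

Lemma spanned_bvec (K : choiceType) (P : K -> Prop) x :
  P x -> spanned P (bvec x).
Proof. by rewrite bvec.unlock; apply: spanned_fbase. Qed.

Lemma spanned_true (K : choiceType) (g : freemod k K) :
  spanned (fun=> True) g.
Proof. by []. Qed.

Lemma spanned_imp (K : choiceType) (P Q : K -> Prop) g :
  (forall x, P x -> Q x) -> spanned P g -> spanned Q g.
Proof. by move=> PQ Pg x /Pg /PQ. Qed.

Lemma spanned_linext (K L : choiceType) (P : K -> Prop) (Q : L -> Prop)
    (F : K -> freemod k L) g :
  (forall x, P x -> spanned Q (F x)) -> spanned P g -> spanned Q (linext F g).
Proof.
move=> PQ Pg y; rewrite -mcoeff_neq0 => gy; apply: contrapT => nQy.
case/negP: gy; apply/eqP; rewrite linext.unlock raddf_sum big_seq big1 //.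
move=> x /Pg /PQ Qx; rewrite [LHS]fm_scaleE.
suff /eqP -> : (F x)@_y == 0 by rewrite mulr0.
by apply: contrapT => /negP; rewrite mcoeff_neq0 => /Qx.
Qed.

Lemma eq_linear_spanned (K : choiceType) (M : lmodType k) (P : K -> Prop)
    (F G : freemod k K -> M) :
  linear F -> linear G -> (forall x, P x -> F (bvec x) = G (bvec x)) ->
  forall g, spanned P g -> F g = G g.
Proof.
move=> lF lG FG g Pg; rewrite (linear_linext _ lF) (linear_linext _ lG).
by apply: eq_linext => x /Pg; apply: FG.
Qed.

Lemma eq_linear (K : choiceType) (M : lmodType k) (F G : freemod k K -> M) :
  linear F -> linear G -> (forall x, F (bvec x) = G (bvec x)) ->
  forall g, F g = G g.
Proof.
by move=> lF lG FG g; apply: (eq_linear_spanned lF lG (P := fun=> True)) => //.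
Qed.

Lemma linear_addf (U V : lmodType k) (F G : U -> V) :
  linear F -> linear G -> linear (fun x => F x + G x).
Proof. by move=> lF lG c x y; rewrite lF lG scalerDr addrACA. Qed.

Lemma linear_scalef (U V : lmodType k) a (F : U -> V) :
  linear F -> linear (fun x => a *: F x).
Proof. by move=> lF c x y; rewrite lF scalerDr !scalerA mulrC. Qed.

End Span.

(** * Composition of Rota-Baxter words *)

Section Words.
Variable X : choiceType.
Notation word := (seq (letter X)).
Notation rbword := (rbword X).
Notation alternating := (alternating (@rbwords X)).

(** The kinds of the first and of the last block of a Rota-Baxter word are
visible on its first and last letters. *)
Definition starts_gen (w : word) : bool :=
  if head Lbr w is Gen _ then true else false.
Definition ends_gen (w : word) : bool :=
  if last Lbr w is Gen _ then true else false.

Definition starts (c : bool) (x : rbword) : Prop := starts_gen (val x) = c.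
Definition ends (c : bool) (x : rbword) : Prop := ends_gen (val x) = c.

(** The condition under which the standard decompositions of [x] and [y] join to
a standard decomposition of [xy]. *)
Definition composable (x y : rbword) : Prop :=
  starts_gen (val y) = ~~ ends_gen (val x).

Definition block (c : bool) (a : rbword) : Prop :=
  if c then exists x, a = rbgen x else exists u, a = rbbr u.

Lemma rbword_rbwords (x : rbword) : rbwords (val x).
Proof. exact: set_mem (valP x). Qed.

Lemma rbwords_val w : rbwords w -> exists x : rbword, val x = w.
Proof. by move=> h; pose x : rbword := exist _ w (mem_set h); exists x. Qed.

Lemma block_starts c a : block c a -> starts_gen (val a) = c.
Proof. by case: c => -[u ->]. Qed.

Lemma block_ends c a : block c a -> ends_gen (val a) = c.
Proof.
case: c => -[u ->] //=.
by rewrite /ends_gen /= last_rcons.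
Qed.

Lemma block_word c w : (if c then @gens X else bracket_set (@rbwords X)) w ->
  exists2 a : rbword, block c a & val a = w.
Proof.
case: c => -[u hu <-]; first by exists (rbgen u) => //; exists u.
have [v <-] := rbwords_val hu.
by exists (rbbr v) => //; exists v.
Qed.

Lemma word_block c a :
  block c a -> (if c then @gens X else bracket_set (@rbwords X)) (val a).
Proof.
case: c => -[u ->]; first by exists u.
by exists (val u) => //; apply: rbword_rbwords.
Qed.

Lemma block_decomp c a : block c a -> std_decomp (val a) [:: val a].
Proof.
move=> ha; split=> //; last by rewrite /= cats0.
by exists c; split=> //; apply: word_block.
Qed.

Lemma rbword_neq0 (x : rbword) : val x <> [::].
Proof.
have /rbwordsP [[|w s] [//= _ [b [/block_word [a ha <-] _] ->]]] :=
  rbword_rbwords x.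
by case: b ha => -[u ->].
Qed.

Lemma starts_gen_cat (x : rbword) w :
  starts_gen (val x ++ w) = starts_gen (val x).
Proof. by have := @rbword_neq0 x; case: (val x). Qed.

Lemma ends_gen_cat (x : rbword) w : ends_gen (w ++ val x) = ends_gen (val x).
Proof.
have := @rbword_neq0 x; case/lastP: (val x) => // u l _.
by rewrite /ends_gen !last_cat !last_rcons.
Qed.

Lemma alternating_starts b s : alternating b s -> s <> [::] ->
  starts_gen (flatten s) = b.
Proof.
case: s => // w s [/block_word [a ha <-] _] _ /=.
by rewrite starts_gen_cat (block_starts ha).
Qed.

Lemma alternating_ends b s : alternating b s -> s <> [::] ->
  ends_gen (flatten s) = ~~ (b (+) odd (size s)).
Proof.
case/lastP: s => // s w; rewrite -cats1 => /alternating_cat [_ [h _]] _.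
have [a ha <-] := block_word h.
rewrite flatten_cat /= cats0 ends_gen_cat (block_ends ha) size_cat addn1 /=.
by rewrite addbN negbK.
Qed.

Lemma std_decomp_cat (x y : rbword) s t : composable x y ->
  std_decomp (val x) s -> std_decomp (val y) t ->
  std_decomp (val x ++ val y) (s ++ t).
Proof.
rewrite /composable => xy [s0 [b als xE]] [t0 [c alt yE]]; split.
- by case: (s) s0.
- exists b; apply/alternating_cat; split=> //.
  move: xy; rewrite xE yE (alternating_starts alt) //.
  by rewrite (alternating_ends als) // negbK => <-.
- by rewrite flatten_cat -xE -yE.
Qed.

Lemma composable_cat (x y : rbword) : composable x y ->
  exists z : rbword, val z = val x ++ val y.
Proof.
move=> xy.
have /rbwordsP [s xs] := rbword_rbwords x.
have /rbwordsP [t yt] := rbword_rbwords y.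
by apply/rbwords_val/rbwordsP; exists (s ++ t); apply: std_decomp_cat.
Qed.

Lemma rbword_of_alternating b s : alternating b s -> s <> [::] ->
  exists x : rbword, val x = flatten s.
Proof.
move=> als s0; apply/rbwords_val/rbwordsP.
by exists s; split=> //; exists b.
Qed.

Lemma split_first (x : rbword) : (exists c, block c x) \/
  exists a y, [/\ exists c, block c a, composable a y & val x = val a ++ val y].
Proof.
have /rbwordsP [[|w s] [// _ [b [h als] xE]]] := rbword_rbwords x.
have [a ha wa] := block_word h.
have [s0|s0] := pselect (s = [::]); [left|right].
  exists b; rewrite (_ : x = a) //.
  by apply: val_inj; rewrite [LHS]xE s0 /= cats0 wa.
have [//|y yE] := rbword_of_alternating als.
exists a, y; split; [by exists b| |by rewrite xE yE wa].
by rewrite /composable yE (alternating_starts als) // (block_ends ha).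
Qed.

Lemma split_last (x : rbword) : (exists c, block c x) \/
  exists y a, [/\ exists c, block c a, composable y a & val x = val y ++ val a].
Proof.
have /rbwordsP [s] := rbword_rbwords x.
case/lastP: s => [[//]|s w] [_ [b]]; rewrite -cats1.
move=> /alternating_cat [als [h _]] xE.
have [a ha wa] := block_word h.
have [s0|s0] := pselect (s = [::]); [left|right].
  exists (b (+) odd (size s)); rewrite (_ : x = a) //.
  by apply: val_inj; rewrite [LHS]xE s0 /= cats0 wa.
have [//|y yE] := rbword_of_alternating als.
exists y, a; split; [by exists (b (+) odd (size s))| |].
  by rewrite /composable yE (alternating_ends als) // (block_starts ha) negbK.
by rewrite xE yE wa flatten_cat /= cats0.
Qed.

Lemma std_decomp_last (x : rbword) :
  exists p (a : rbword), std_decomp (val x) (rcons p (val a)).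
Proof.
have [[c ha]|[y [a [[c ha] ya ->]]]] := split_last x.
  by exists [::], x; apply: block_decomp ha.
have /rbwordsP [s ys] := rbword_rbwords y.
by exists s, a; rewrite -cats1; apply: std_decomp_cat ys (block_decomp ha).
Qed.

Lemma std_decomp_first (x : rbword) :
  exists (a : rbword) q, std_decomp (val x) (val a :: q).
Proof.
have [[c ha]|[a [y [[c ha] ay ->]]]] := split_first x.
  by exists x, [::]; apply: block_decomp ha.
have /rbwordsP [s ys] := rbword_rbwords y.
by exists a, s; apply: (std_decomp_cat ay (block_decomp ha)).
Qed.

(** Structural induction on Rota-Baxter words; unlike the induction on depth
that defines them, it peels off one block or one pair of brackets at a time. *)
Lemma rbword_concat_ind (P : rbword -> Prop) :
  (forall x, P (rbgen x)) -> (forall u, P u -> P (rbbr u)) ->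
  (forall x y z, composable x y -> val z = val x ++ val y ->
     P x -> P y -> P z) ->
  forall x, P x.
Proof.
move=> Pgen Pbr Pcat x; have [n] := ubnP (size (val x)).
have size_gt0 (z : rbword) : (0 < size (val z))%N.
  by have := @rbword_neq0 z; case: (val z).
elim: n x => // n IH x; rewrite ltnS => xn.
have [[[] [u xE]]|[a [y [_ ay xE]]]] := split_first x.
- by rewrite xE.
- rewrite xE; apply/Pbr/IH; apply: leq_trans xn.
  by rewrite xE /= size_rcons ltnS leqnSn.
move: xn; rewrite xE size_cat => xn.
apply: (Pcat a y) => //; apply: IH; apply: leq_trans xn.
  by rewrite -addn1 leq_add2l.
by rewrite -add1n leq_add2r.
Qed.

End Words.

(** * The product on composable words *)

Section Product.
Local Open Scope ring_scope.
Variables (k : comPzRingType) (lam : k).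
Variables (B : lmodType k) (mulB : B -> B -> B) (X : choiceType) (e : X -> B).
Notation word := (seq (letter X)).
Notation rbword := (rbword X).
Notation Sha := (Sha k X).
Notation "f ** g" := (diamond lam mulB e f g) (at level 40, left associativity).
Notation D := (diamond_base lam mulB e).
Notation R_B := (@R_B k X).

Let SD := diamond_baseP lam mulB e.

(** [Defs.wrap p q] factors as [word_cat p q] after [as_words]; unlike
[Defs.wrap], the maps [word_cat p q] compose with one another. *)
Definition word_cat (p q : word) : freemod k word -> freemod k word :=
  linext (fun w => bvec (p ++ w ++ q)).

Lemma word_cat_linear p q : linear (word_cat p q).
Proof. exact: linext_is_linear. Qed.

Lemma word_cat_base p q w : word_cat p q (bvec w) = bvec (p ++ w ++ q).
Proof. exact: linext_bvec. Qed.

Lemma word_cat_cat p q p' q' g :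
  word_cat p q (word_cat p' q' g) = word_cat (p ++ p') (q' ++ q) g.
Proof.
move: g; apply: eq_linear => [||w].
- by apply: linear_comp; apply: word_cat_linear.
- exact: word_cat_linear.
by rewrite !word_cat_base !catA.
Qed.

Lemma as_words_linear : linear (@as_words k X).
Proof. exact: linext_is_linear. Qed.

Lemma as_words_base (x : rbword) :
  as_words (bvec x) = bvec (val x) :> freemod k word.
Proof. by rewrite /as_words /Defs.wrap linext_bvec /= cats0 bvec.unlock. Qed.

Lemma wrapE p q (g : Sha) : Defs.wrap p q g = word_cat p q (as_words g).
Proof.
move: g; apply: eq_linear => [||w].
- exact: linext_is_linear.
- by apply: linear_comp; [apply: word_cat_linear|apply: as_words_linear].
by rewrite as_words_base word_cat_base /Defs.wrap linext_bvec bvec.unlock.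
Qed.

(** The support of [g] can be read off its image in the free module on all
words, because [as_words] has a linear left inverse acting on basis vectors. *)
Lemma spanned_as_words (P : word -> Prop) (g : Sha) :
  spanned P (as_words g) -> spanned (fun x => P (val x)) g.
Proof.
pose back (w : word) : Sha := oapp (@bvec k _) 0 (insub w : option rbword).
have {2}-> : g = linext back (as_words g).
  move: g; apply: eq_linear => [//||x].
    by apply: linear_comp; [apply: linext_is_linear|apply: as_words_linear].
  by rewrite as_words_base linext_bvec /back valK.
apply: spanned_linext => w Pw; rewrite /back.
case: insubP => [x _ xw|_] /=; last by move=> x; rewrite msupp0 inE.
by apply: spanned_bvec; rewrite xw.
Qed.

Lemma as_words_spanned (P : word -> Prop) (g : Sha) :
  spanned (fun x => P (val x)) g -> spanned P (as_words g).
Proof.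
rewrite /as_words /Defs.wrap; apply: spanned_linext => x Px.
by apply: spanned_fbase; rewrite /= cats0.
Qed.

Lemma spanned_word_cat p q (P Q : word -> Prop) g :
  (forall w, P w -> Q (p ++ w ++ q)) -> spanned P g ->
  spanned Q (word_cat p q g).
Proof. by move=> PQ; apply: spanned_linext => w /PQ; apply: spanned_bvec. Qed.

Lemma diamond_linear_l g : linear (fun f => f ** g).
Proof. exact: linext_is_linear. Qed.

Lemma diamond_linear_r f : linear (fun g => f ** g).
Proof. by apply: linear_linext_param => x; apply: linext_is_linear. Qed.

Lemma diamond_bvec x y : bvec x ** bvec y = D x y.
Proof. by rewrite /diamond !linext_bvec. Qed.

Lemma R_B_linear : linear R_B.
Proof. exact: linext_is_linear. Qed.

Lemma R_B_base u : R_B (bvec u) = bvec (rbbr u).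
Proof. by rewrite bvec.unlock; apply: linext_base. Qed.

Lemma spanned_j_B b : spanned (block true) (j_B e b).
Proof.
apply: (spanned_linext (P := fun=> True)) => // x _.
by apply: spanned_fbase; exists x.
Qed.

Lemma spanned_R_B g : spanned (block false) (R_B g).
Proof.
apply: (spanned_linext (P := fun=> True)) => // x _.
by apply: spanned_fbase; exists x.
Qed.

Lemma R_BD f g : R_B (f + g) = R_B f + R_B g.
Proof. exact: linextD. Qed.

Lemma R_BZ a f : R_B (a *: f) = a *: R_B f.
Proof. exact: linextZ. Qed.

(** The defining equation for two bracketed words, extended bilinearly. *)
Lemma R_BM f g :
  R_B f ** R_B g = R_B (R_B f ** g + f ** R_B g + lam *: (f ** g)).
Proof.
have [[lR lr] ll] := (R_B_linear, diamond_linear_r, diamond_linear_l).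
move: f; apply: eq_linear => [||u].
- exact: linear_comp (ll _) lR.
- apply: (linear_comp lR); apply: linear_addf (linear_scalef _ (ll g)).
  exact: linear_addf (linear_comp (ll g) lR) (ll _).
move: g; apply: eq_linear => [||v].
- exact: linear_comp (lr _) lR.
- apply: (linear_comp lR); apply: linear_addf (linear_scalef _ (lr _)).
  exact: linear_addf (lr _) (linear_comp (lr _) lR).
have := diamond_br_br SD u v.
by rewrite -!diamond_bvec -R_BZ -!R_BD -!R_B_base.
Qed.

(** Writing [x] in front of the left factor commutes with the product as long as
the last block of the left factor, the only one that interacts with [y], stays
in place.  The next lemma is its mirror image. *)
Lemma diamond_catl x x' z y : composable x x' -> val z = val x ++ val x' ->
  as_words (D z y) = word_cat (val x) [::] (as_words (D x' y)).
Proof.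
move=> xx' zE.
have /rbwordsP [s xs] := rbword_rbwords x.
have [p [a x'p]] := std_decomp_last x'.
have [b [q yq]] := std_decomp_first y.
have zs : std_decomp (val z) (rcons (s ++ p) (val a)).
  by rewrite zE rcons_cat; apply: std_decomp_cat.
rewrite (diamond_concat SD zs yq) (diamond_concat SD x'p yq) !wrapE.
by rewrite word_cat_cat cats0 flatten_cat; have [_ [_ _ ->]] := xs.
Qed.

Lemma diamond_catr x y y' z : composable y y' -> val z = val y ++ val y' ->
  as_words (D x z) = word_cat [::] (val y') (as_words (D x y)).
Proof.
move=> yy' zE.
have /rbwordsP [s ys] := rbword_rbwords y'.
have [p [a xp]] := std_decomp_last x.
have [b [q yq]] := std_decomp_first y.
have zs : std_decomp (val z) (val b :: (q ++ s)).
  by rewrite zE -cat_cons; apply: std_decomp_cat.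
rewrite (diamond_concat SD xp zs) (diamond_concat SD xp yq) !wrapE.
by rewrite word_cat_cat flatten_cat; have [_ [_ _ ->]] := ys.
Qed.

Lemma diamond_block_composable c a b : block c a -> block (~~ c) b ->
  as_words (D a b) = bvec (val a ++ val b).
Proof.
rewrite bvec.unlock; case: c => -[x ->] [y ->].
  exact: diamond_gen_br SD _ _.
exact: diamond_br_gen SD _ _.
Qed.

(** Peeling off the blocks before the last one of [x] and after the first one of
[y] leaves two single blocks of different kinds. *)
Lemma diamond_composable x y z : composable x y -> val z = val x ++ val y ->
  D x y = bvec z.
Proof.
move=> xy zE; apply: as_words_inj; rewrite as_words_base zE {z zE}.
wlog: x xy / exists c, block c x => [wl|[c xc]].
  have [//|[x' [a [ha xa xE]]]] := split_last x; first exact: wl.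
  have ay : composable a y by move: xy; rewrite /composable xE ends_gen_cat.
  by rewrite (diamond_catl _ xa xE) wl // word_cat_base cats0 xE catA.
wlog: y xy / exists d, block d y => [wl|[d yd]].
  have [//|[b [y' [hb yb yE]]]] := split_first y; first exact: wl.
  have xb : composable x b by move: xy; rewrite /composable yE starts_gen_cat.
  by rewrite (diamond_catr _ yb yE) wl // word_cat_base yE catA.
apply: (diamond_block_composable xc).
by move: xy; rewrite /composable (block_starts yd) (block_ends xc) => <-.
Qed.

(** Two generators multiply inside [B], and the product of two brackets is in
the image of [R_B] by the Rota-Baxter identity. *)
Lemma diamond_block c a b : block c a -> block c b -> spanned (block c) (D a b).
Proof.
case: c => -[x ->] [y ->].
  by rewrite (diamond_gen_gen SD); apply: spanned_j_B.
by rewrite -diamond_bvec -!R_B_base R_BM; apply: spanned_R_B.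
Qed.

(** The first block of [x] is untouched by the product unless [x] is a single
block; then it is either kept or merged with a block of the same kind, by
[diamond_composable] or [diamond_block]. *)
Lemma diamond_starts x y :
  spanned (starts (starts_gen (val x))) (D x y).
Proof.
have [[c xc]|[a [x' [_ ax' xE]]]] := split_first x; last first.
  apply: (@spanned_as_words (fun w => starts_gen w = starts_gen (val x))).
  rewrite (diamond_catl _ ax' xE).
  apply: (@spanned_word_cat _ _ (fun=> True)) => // w _.
  by rewrite xE !starts_gen_cat.
wlog: y / exists d, block d y => [wl|[d yd]].
  have [//|[b [y' [hb yb yE]]]] := split_first y; first exact: wl.
  apply: (@spanned_as_words (fun w => starts_gen w = starts_gen (val x))).
  rewrite (diamond_catr _ yb yE).
  have : spanned (fun w => exists2 u : rbword, val u = w &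
      starts_gen w = starts_gen (val x)) (as_words (D x b)).
    by apply: as_words_spanned; apply: spanned_imp (wl b hb) => u ?; exists u.
  by apply: spanned_word_cat => _ [u <- ux]; rewrite /= starts_gen_cat.
have [cd|cd] := eqVneq c d.
  rewrite -cd in yd; apply: spanned_imp (diamond_block xc yd) => w wc.
  by rewrite /starts (block_starts wc) (block_starts xc).
have xy : composable x y.
  rewrite /composable (block_starts yd) (block_ends xc).
  by case: (c) (d) cd => -[].
have [z zE] := composable_cat xy.
rewrite (diamond_composable xy zE); apply: spanned_bvec.
by rewrite /starts zE starts_gen_cat.
Qed.

Lemma diamond_ends x y :
  spanned (ends (ends_gen (val y))) (D x y).
Proof.
have [[c yc]|[y' [b [_ yb yE]]]] := split_last y; last first.
  apply: (@spanned_as_words (fun w => ends_gen w = ends_gen (val y))).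
  rewrite (diamond_catr _ yb yE).
  apply: (@spanned_word_cat _ _ (fun=> True)) => // w _.
  by rewrite yE !ends_gen_cat.
wlog: x / exists d, block d x => [wl|[d xd]].
  have [//|[x' [a [ha xa xE]]]] := split_last x; first exact: wl.
  apply: (@spanned_as_words (fun w => ends_gen w = ends_gen (val y))).
  rewrite (diamond_catl _ xa xE).
  have : spanned (fun w => exists2 u : rbword, val u = w &
      ends_gen w = ends_gen (val y)) (as_words (D a y)).
    by apply: as_words_spanned; apply: spanned_imp (wl a ha) => u ?; exists u.
  by apply: spanned_word_cat => _ [u <- ux]; rewrite cats0 ends_gen_cat.
have [cd|cd] := eqVneq c d.
  rewrite -cd in xd; apply: spanned_imp (diamond_block xd yc) => w wc.
  by rewrite /ends (block_ends wc) (block_ends yc).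
have xy : composable x y.
  rewrite /composable (block_starts yc) (block_ends xd).
  by case: (c) (d) cd => -[].
have [z zE] := composable_cat xy.
rewrite (diamond_composable xy zE); apply: spanned_bvec.
by rewrite /ends zE ends_gen_cat.
Qed.

Lemma spanned_diamond_starts c f g :
  spanned (starts c) f ->
  spanned (starts c) (f ** g).
Proof.
apply: spanned_linext => x <-; apply: (spanned_linext (P := fun=> True)) => //.
by move=> y _; apply: diamond_starts.
Qed.

Lemma spanned_diamond_ends c f g :
  spanned (ends c) g ->
  spanned (ends c) (f ** g).
Proof.
move=> gc; apply: (spanned_linext (P := fun=> True)) => // x _.
by apply: spanned_linext gc => y <-; apply: diamond_ends.
Qed.

Lemma as_words_diamondl x g :
  spanned (composable x) g ->
  as_words (bvec x ** g) = word_cat (val x) [::] (as_words g).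
Proof.
have law := as_words_linear.
move: g; apply: eq_linear_spanned => [||y xy].
- exact: linear_comp law (diamond_linear_r _).
- exact: linear_comp (word_cat_linear _ _) law.
have [z zE] := composable_cat xy.
rewrite diamond_bvec (diamond_composable xy zE) !as_words_base.
by rewrite word_cat_base cats0 zE.
Qed.

Lemma as_words_diamondr g y :
  spanned (fun x => composable x y) g ->
  as_words (g ** bvec y) = word_cat [::] (val y) (as_words g).
Proof.
have law := as_words_linear.
move: g; apply: eq_linear_spanned => [||x xy].
- exact: linear_comp law (diamond_linear_l _).
- exact: linear_comp (word_cat_linear _ _) law.
have [z zE] := composable_cat xy.
rewrite diamond_bvec (diamond_composable xy zE) !as_words_base.
by rewrite word_cat_base zE.
Qed.

Lemma bvec_cat x y z : composable x y -> val z = val x ++ val y ->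
  bvec z = bvec x ** bvec y.
Proof. by move=> xy zE; rewrite diamond_bvec (diamond_composable xy zE). Qed.

(** * Associativity *)

(** Associativity of a single triple, since the cases below hold under different
conditions on the factors. *)
Definition associates f g h := (f ** g) ** h = f ** (g ** h).

Lemma associates_spanned (P Q S : rbword -> Prop) f g h :
  (forall x y z, P x -> Q y -> S z ->
     associates (bvec x) (bvec y) (bvec z)) ->
  spanned P f -> spanned Q g -> spanned S h -> associates f g h.
Proof.
have [lr ll] := (diamond_linear_r, diamond_linear_l).
rewrite /associates => PQS Pf Qg Sh.
move: f Pf; apply: eq_linear_spanned => [||x Px].
- exact: linear_comp (ll _) (ll _).
- exact: ll.
move: g Qg; apply: eq_linear_spanned => [||y Qy].
- exact: linear_comp (ll _) (lr _).
- exact: linear_comp (lr _) (ll _).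
move: h Sh; apply: eq_linear_spanned => [||z Sz].
- exact: lr.
- exact: linear_comp (lr _) (lr _).
exact: PQS.
Qed.

(** Both sides are [g ** h] with the words of [f] written in front: the words of
[g ** h] start like those of [g], hence are still composable with them. *)
Lemma associates_left c f g h :
  spanned (ends c) f ->
  spanned (starts (~~ c)) g -> associates f g h.
Proof.
move=> fc gc; apply: associates_spanned fc gc (@spanned_true _ _ h).
move=> x y z xc yc _; have xy : composable x y by rewrite /composable xc.
have [w wE] := composable_cat xy.
rewrite /associates -(bvec_cat xy wE) (diamond_bvec w z) (diamond_bvec y z).
apply: as_words_inj; rewrite (diamond_catl _ xy wE) as_words_diamondl //.
by apply: spanned_imp (@diamond_starts y z) => u; rewrite /composable xc -yc.
Qed.

Lemma associates_right c f g h :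
  spanned (ends c) g ->
  spanned (starts (~~ c)) h -> associates f g h.
Proof.
move=> gc hc; apply: associates_spanned (@spanned_true _ _ f) gc hc.
move=> x y z _ yc zc; have yz : composable y z by rewrite /composable yc.
have [w wE] := composable_cat yz.
rewrite /associates -(bvec_cat yz wE) (diamond_bvec x w) (diamond_bvec x y).
apply: as_words_inj; rewrite (diamond_catr _ yz wE) as_words_diamondr //.
apply: spanned_imp (@diamond_ends x y) => u.
by rewrite /composable zc -yc => ->.
Qed.

Lemma spanned_ends x :
  spanned (ends (ends_gen (val x))) (bvec x : Sha).
Proof. exact: spanned_bvec. Qed.

(** Parentheses move freely across a composable cut, so each factor can be cut
down to the block that takes part in the interaction.  The bounds on the sizes
keep the three blocks within reach of an induction on total length. *)
Lemma associates_of_blocks (x y z : rbword) :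
  (forall c a b d, block c a -> block c b -> block c d ->
     (size (val a) <= size (val x))%N -> (size (val b) <= size (val y))%N ->
     (size (val d) <= size (val z))%N ->
     associates (bvec a) (bvec b) (bvec d)) ->
  associates (bvec x) (bvec y) (bvec z).
Proof.
have sl := spanned_diamond_starts; have sr := spanned_diamond_ends.
have be := spanned_ends.
(* If [y = b y'] with [y'] nonempty, both sides are [(x ** b) ** (y' ** z)]. *)
wlog: y / exists c, block c y => [wl|[c yc]].
  have [|[b [y' [hb yb yE]]]] := split_first y; first exact: wl.
  rewrite /associates (bvec_cat yb yE) => _.
  have sy' : spanned (starts (~~ ends_gen (val b))) (bvec y' : Sha).
    exact: spanned_bvec.
  have e1 := associates_right (bvec x) (be b) sy'.
  have e2 := associates_left (bvec z) (sr _ (bvec x) _ (be b)) sy'.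
  have e3 := associates_right (bvec x) (be b) (sl _ _ (bvec z) sy').
  have e4 := associates_left (bvec z) (be b) sy'.
  by rewrite -e1 e2 e3 e4.
wlog: x / exists d, block d x => [wl|[d xd]].
  have [|[x' [a [ha xa xE]]]] := split_last x; first exact: wl.
  move=> H; have aI : associates (bvec a) (bvec y) (bvec z).
    apply: wl => // c' a' b' d' ha' hb' hd' sa sb sd.
    apply: H ha' hb' hd' _ sb sd.
    by apply: leq_trans sa _; rewrite xE size_cat leq_addl.
  have sa : spanned (starts (~~ ends_gen (val x'))) (bvec a : Sha).
    exact: spanned_bvec.
  rewrite /associates (bvec_cat xa xE).
  have e1 := associates_left (bvec y) (be x') sa.
  have e2 := associates_left (bvec z) (be x') (sl _ _ (bvec y) sa).
  have e3 := associates_left (bvec y ** bvec z) (be x') sa.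
  by rewrite e1 e2 aI e3.
wlog: z / exists d, block d z => [wl|[d' zd]].
  have [|[a [z' [ha xa xE]]]] := split_first z; first exact: wl.
  move=> H; have aI : associates (bvec x) (bvec y) (bvec a).
    apply: wl => // c' a' b' d' ha' hb' hd' sa sb sd.
    apply: H ha' hb' hd' sa sb _.
    by apply: leq_trans sd _; rewrite xE size_cat leq_addr.
  have sz : spanned (starts (~~ ends_gen (val a))) (bvec z' : Sha).
    exact: spanned_bvec.
  rewrite /associates (bvec_cat xa xE).
  have e1 := associates_right (bvec y) (be a) sz.
  have e2 := associates_right (bvec x) (sr _ (bvec y) _ (be a)) sz.
  have e3 := associates_right (bvec x ** bvec y) (be a) sz.
  by rewrite -e1 -e2 -aI e3.
have [dc|dc] := boolP (d == c); last first.
  move=> _; apply: (associates_left _ (be x)); apply: spanned_bvec.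
  by rewrite /starts (block_ends xd) (block_starts yc); case: (c) (d) dc => -[].
have [cd|cd] := boolP (d' == c); last first.
  move=> _; apply: (associates_right _ (be y)); apply: spanned_bvec.
  rewrite /starts (block_ends yc) (block_starts zd).
  by case: (c) (d') cd => -[].
move: xd zd; rewrite (eqP dc) (eqP cd) => xd zd.
by move=> H; apply: (H c).
Qed.

(** * The embedding of the algebra *)

Section Basis.
Hypotheses (hB : nu_algebra mulB) (he : is_basis e).

Lemma coordK b : linext e (Defs.coord e b) = b.
Proof.
have [_ /(_ b) [c cb]] := he.
suff : [set c | linext e c = b]%classic (Defs.coord e b) by [].
by apply: xgetPex; exists c.
Qed.

Lemma linext_basis_inj c d : linext e c = linext e d -> c = d.
Proof.
move=> cd; apply/eqP; rewrite -subr_eq0; apply/eqP.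
by have [inj _] := he; apply: inj; rewrite linearB /= cd subrr.
Qed.

Lemma linextK c : Defs.coord e (linext e c) = c.
Proof. by apply: linext_basis_inj; rewrite coordK. Qed.

Lemma j_B_linear : linear (j_B e : B -> Sha).
Proof.
move=> a b c; rewrite /j_B -linextZ -linextD; congr linext.
by apply: linext_basis_inj; rewrite linextD linextZ !coordK.
Qed.

Lemma j_B_basis x : j_B e (e x) = bvec (rbgen x) :> Sha.
Proof. by rewrite -(linext_bvec e x) /j_B linextK linext_bvec bvec.unlock. Qed.

Lemma j_BM b c : j_B e (mulB b c) = j_B e b ** j_B e c.
Proof.
have [mulBl mulBr _] := hB.
have lE : linear (linext e) by apply: linext_is_linear.
have lj := linear_comp j_B_linear lE.
rewrite -(coordK b) -(coordK c).
move: (Defs.coord e b); apply: eq_linear => [||x].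
- exact: linear_comp j_B_linear (linear_comp (mulBl _) lE).
- exact: linear_comp (diamond_linear_l _) lj.
move: (Defs.coord e c); apply: eq_linear => [||y].
- exact: linear_comp j_B_linear (linear_comp (mulBr _) lE).
- exact: linear_comp (diamond_linear_r _) lj.
by rewrite !linext_bvec !j_B_basis diamond_bvec (diamond_gen_gen SD).
Qed.

(** * Associativity on all elements *)

Lemma diamond_assoc : associative (diamond lam mulB e).
Proof.
move=> f g h; apply: esym.
apply: (@associates_spanned (fun=> True) (fun=> True) (fun=> True)) => //.
move=> x y z _ _ _.
have [n] := ubnP (size (val x) + size (val y) + size (val z)).
elim: n x y z => // n IH x y z; rewrite ltnS => xyz.
apply: associates_of_blocks => -[] a b d [u aE] [v bE] [w dE] xa yb zd.
  have [_ _ mulBA] := hB.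
  by rewrite /associates aE bE dE -!j_B_basis -!j_BM mulBA.
have {xa yb zd} := leq_trans (leq_add (leq_add xa yb) zd) xyz.
rewrite {}aE {}bE {}dE /= !size_rcons !(addnS, addSn) => uvw.
rewrite -!R_B_base; apply: (rota_baxter_assoc (lam := lam) (R := R_B)).
- exact: diamond_linear_l.
- exact: diamond_linear_r.
- exact: R_B_linear.
- exact: R_BM.
all: rewrite ?R_B_base; apply: IH; apply: leq_trans uvw.
all: rewrite /= ?size_rcons ?(addnS, addSn) ?ltnS.
all: by do ?[exact: leqnn | apply: leqW].
Qed.

(** * The universal property *)

Section Universal.
Variables (A : lmodType k) (mulA : A -> A -> A) (R : A -> A) (f : B -> A).
Hypotheses (hA : rota_baxter lam mulA R) (hf : nu_hom mulB mulA f).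

(** Multiplication by [a] on the right, where [None] stands for the empty
product, as [A] need not have a unit. *)
Definition push (c : option A) (a : A) : option A :=
  Some (if c is Some b then mulA b a else a).

(** One step of a machine that evaluates a word from left to right: the first
component is the product read so far inside the innermost open bracket, the
stack holds the interrupted products of the enclosing ones. *)
Definition step (s : option A * seq (option A)) (l : letter X) :=
  match l, s with
  | Gen x, (c, st) => (push c (f (e x)), st)
  | Lbr, (c, st) => (None, c :: st)
  | Rbr, (c, [::]) => (c, [::])
  | Rbr, (c, p :: st) => (push p (R (odflt 0 c)), st)
  end.

Definition eval (x : rbword) : A :=
  odflt 0 (foldl step (None, [::]) (val x)).1.

(** Reading a Rota-Baxter word amounts to one multiplication by its value.  In
the concatenation case this is where the associativity of [A] enters. *)
Lemma foldl_step x s : foldl step s (val x) = (push s.1 (eval x), s.2).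
Proof.
have [[_ _ mulAA] _ _] := hA.
elim/rbword_concat_ind: x s => [x|u IH|x y z _ zE IHx IHy] [c st].
- by [].
- by rewrite /eval /= !foldl_rcons (IH (None, c :: st)) (IH (None, [:: None])).
- rewrite /eval zE !foldl_cat !IHx !IHy /=; congr (_, _).
  by case: c => //= c; rewrite /push mulAA.
Qed.

Lemma eval_gen x : eval (rbgen x) = f (e x).
Proof. by []. Qed.

Lemma eval_br u : eval (rbbr u) = R (eval u).
Proof. by rewrite {1}/eval /= foldl_rcons foldl_step. Qed.

Lemma eval_cat x y z :
  val z = val x ++ val y -> eval z = mulA (eval x) (eval y).
Proof. by move=> zE; rewrite {1}/eval zE foldl_cat !foldl_step. Qed.

Definition fbar : Sha -> A := linext eval.

Lemma fbar_linear : linear fbar.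
Proof. exact: linext_is_linear. Qed.

Lemma fbar_bvec x : fbar (bvec x) = eval x.
Proof. exact: linext_bvec. Qed.

Lemma fbar_R_B g : fbar (R_B g) = R (fbar g).
Proof.
have [_ lR _] := hA.
move: g; apply: eq_linear => [||u].
- exact: linear_comp fbar_linear R_B_linear.
- exact: linear_comp lR fbar_linear.
by rewrite R_B_base !fbar_bvec eval_br.
Qed.

Lemma fbar_j_B b : fbar (j_B e b) = f b.
Proof.
have [lf _] := hf.
rewrite -(coordK b); move: (Defs.coord e b); apply: eq_linear => [||x].
- apply: (linear_comp (linear_comp fbar_linear j_B_linear)).
  exact: linext_is_linear.
- by apply: (linear_comp lf); apply: linext_is_linear.
by rewrite linext_bvec j_B_basis fbar_bvec eval_gen.
Qed.

Definition fbar_multiplicative g h := fbar (g ** h) = mulA (fbar g) (fbar h).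

Lemma fbar_multiplicative_spanned (P Q : rbword -> Prop) g h :
  (forall x y, P x -> Q y -> fbar_multiplicative (bvec x) (bvec y)) ->
  spanned P g -> spanned Q h -> fbar_multiplicative g h.
Proof.
have [[ml mr _] _ _] := hA; have lfb := fbar_linear.
rewrite /fbar_multiplicative => PQ Pg Qh.
move: g Pg; apply: eq_linear_spanned => [||x Px].
- exact: linear_comp lfb (diamond_linear_l _).
- exact: linear_comp (ml _) lfb.
move: h Qh; apply: eq_linear_spanned => [||y Qy].
- exact: linear_comp lfb (diamond_linear_r _).
- exact: linear_comp (mr _) lfb.
exact: PQ.
Qed.

Lemma fbar_multiplicative_composable c g h :
  spanned (ends c) g ->
  spanned (starts (~~ c)) h -> fbar_multiplicative g h.
Proof.
apply: fbar_multiplicative_spanned => x y xc yc.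
have xy : composable x y by rewrite /composable xc.
have [z zE] := composable_cat xy.
by rewrite /fbar_multiplicative -(bvec_cat xy zE) !fbar_bvec (eval_cat zE).
Qed.

(** As in [associates_of_blocks]: once [x = x' a] is cut, [x'] only gets
concatenated to [a ** y], and [fbar] respects concatenation. *)
Lemma fbar_multiplicative_of_blocks (x y : rbword) :
  (forall c a b, block c a -> block c b ->
     (size (val a) <= size (val x))%N -> (size (val b) <= size (val y))%N ->
     fbar_multiplicative (bvec a) (bvec b)) ->
  fbar_multiplicative (bvec x) (bvec y).
Proof.
have [[_ _ mulAA] _ _] := hA.
have be := spanned_ends.
wlog: x / exists d, block d x => [wl|[d xd]].
  have [|[x' [a [ha xa xE]]]] := split_last x; first exact: wl.
  move=> H; have aM : fbar_multiplicative (bvec a) (bvec y).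
    apply: wl => // c a' b ha' hb sa; apply: H ha' hb _.
    by apply: leq_trans sa _; rewrite xE size_cat leq_addl.
  have sa : spanned (starts (~~ ends_gen (val x'))) (bvec a : Sha).
    exact: spanned_bvec.
  rewrite /fbar_multiplicative (bvec_cat xa xE) -diamond_assoc.
  have fM_x' := fbar_multiplicative_composable (be x').
  rewrite (fM_x' _ (spanned_diamond_starts sa)) aM.
  by rewrite (fM_x' _ sa) mulAA.
wlog: y / exists c, block c y => [wl|[c yc]].
  have [|[b [y' [hb yb yE]]]] := split_first y; first exact: wl.
  move=> H; have bM : fbar_multiplicative (bvec x) (bvec b).
    apply: wl => // c a' b' ha' hb' sa' sb; apply: H ha' hb' sa' _.
    by apply: leq_trans sb _; rewrite yE size_cat leq_addr.
  have sy : spanned (starts (~~ ends_gen (val b))) (bvec y' : Sha).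
    exact: spanned_bvec.
  rewrite /fbar_multiplicative (bvec_cat yb yE) diamond_assoc.
  rewrite (fbar_multiplicative_composable (spanned_diamond_ends (be b)) sy) bM.
  by rewrite (fbar_multiplicative_composable (be b) sy) mulAA.
have [dc|dc] := boolP (d == c); last first.
  move=> _; apply: (fbar_multiplicative_composable (be x)); apply: spanned_bvec.
  by rewrite /starts (block_ends xd) (block_starts yc); case: (c) (d) dc => -[].
by rewrite (eqP dc) in xd; move=> H; apply: (H c).
Qed.

Lemma fbarM g h : fbar (g ** h) = mulA (fbar g) (fbar h).
Proof.
have [_ _ RA] := hA; have [_ fM] := hf.
apply: (@fbar_multiplicative_spanned (fun=> True) (fun=> True)) => // x y _ _.
have [n] := ubnP (size (val x) + size (val y)).
elim: n x y => // n IH x y; rewrite ltnS => xy.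
apply: fbar_multiplicative_of_blocks => -[] a b [u aE] [v bE] xa yb.
  by rewrite /fbar_multiplicative aE bE -!j_B_basis -j_BM !fbar_j_B fM.
have {xa yb} := leq_trans (leq_add xa yb) xy.
rewrite {}aE {}bE /= !size_rcons !(addnS, addSn) => uv.
(* The four extra letters are the two pairs of brackets. *)
have mul1 x' y' :
    (size (val x') + size (val y') < (size (val u) + size (val v)).+4)%N ->
    fbar_multiplicative (bvec x') (bvec y').
  by move=> lt; apply: IH; apply: leq_trans lt uv.
rewrite -!R_B_base /fbar_multiplicative R_BM !fbar_R_B RA; congr R.
rewrite !(linear_add _ _ fbar_linear) (linear_scale _ _ fbar_linear).
have -> : fbar (R_B (bvec u) ** bvec v) =
    mulA (R (fbar (bvec u))) (fbar (bvec v)).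
  rewrite -fbar_R_B R_B_base; apply: mul1.
  by rewrite /= size_rcons !addSn; do ?[exact: leqnn | apply: leqW].
have -> : fbar (bvec u ** R_B (bvec v)) =
    mulA (fbar (bvec u)) (R (fbar (bvec v))).
  rewrite -fbar_R_B R_B_base; apply: mul1.
  by rewrite /= size_rcons !addnS; do ?[exact: leqnn | apply: leqW].
by rewrite mul1 //; do ?[exact: leqnn | apply: leqW].
Qed.

Lemma fbar_unique (g : Sha -> A) :
  rb_hom (diamond lam mulB e) R_B mulA R g -> (forall b, g (j_B e b) = f b) ->
  fbar =1 g.
Proof.
move=> [[lg gM] gR] gj; apply: eq_linear => // [|x]; first exact: fbar_linear.
rewrite fbar_bvec; elim/rbword_concat_ind: x => [x|u IH|x y z xy zE IHx IHy].
- by rewrite eval_gen -j_B_basis gj.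
- by rewrite eval_br -R_B_base gR IH.
- by rewrite (eval_cat zE) (bvec_cat xy zE) gM IHx IHy.
Qed.

End Universal.
End Basis.
End Product.

Theorem theorem2p6 (k : comPzRingType) (lam : k)
    (B : lmodType k) (mulB : B -> B -> B) (hB : nu_algebra mulB)
    (X : choiceType) (e : X -> B) (he : is_basis e) :
  [/\ nu_algebra (diamond lam mulB e),
      rota_baxter lam (diamond lam mulB e) (@R_B k X) &
      nu_hom mulB (diamond lam mulB e) (j_B e) /\
      (forall (A : lmodType k) (mulA : A -> A -> A) (R : A -> A),
         rota_baxter lam mulA R ->
         forall f : B -> A, nu_hom mulB mulA f ->
         exists! fbar : Sha k X -> A,
           rb_hom (diamond lam mulB e) (@R_B k X) mulA R fbar /\
           (forall b : B, fbar (j_B e b) = f b))].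
Proof.
have algS : nu_algebra (diamond lam mulB e).
  split; [exact: diamond_linear_l|exact: diamond_linear_r|].
  exact: diamond_assoc.
split=> //.
  by split=> //; [apply: R_B_linear|apply: R_BM].
split; first by split; [apply: j_B_linear|apply: j_BM].
move=> A mulA R hA f hf; exists (fbar e mulA R f); split.
  split; last exact: (fbar_j_B he R hf).
  split; last exact: (fbar_R_B e f hA).
  by split; [apply: fbar_linear|apply: (fbarM hB he hA hf)].
move=> g [hg gj]; apply: funext; exact: (fbar_unique he hA hg gj).
Qed.
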